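(* Let $d\ge1$, $\sigma>0$, and let $A_0,A_1\in\mathbb{R}^{d\times d}$ be constant matrices with $A_0A_1\ne A_1A_0$. Let $\Psi:[-\sigma,0]\to\mathbb{R}^{d\times d}$ be continuously differentiable with $A_1\Psi(\vartheta)=\Psi(\vartheta)A_1$ for all $\vartheta\in[-\sigma,0]$. Let $Z$ be the function defined in the context. Then \[ X(\vartheta)=Z(\vartheta)\Psi(-\sigma)+\int_{-\sigma}^{0}Z(\vartheta-\sigma-s)\dot\Psi(s)\,ds,\qquad \vartheta\in[-\sigma,\infty), \] is a solution of \[ \dot X(\vartheta)=A_0X(\vartheta-\sigma)+X(\vartheta-\sigma)A_1,\ \ \vartheta\in[0,\infty),\qquad X(\vartheta)=\Psi(\vartheta),\ \ \vartheta\in[-\sigma,0]. \]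
   Context: $\Theta$ and $I$ denote the $d\times d$ zero and identity matrices. Define matrices $Q_{r+1}(r\sigma)$, $r=0,1,2,\dots$, recursively by $Q_1(0)=I$ and $Q_{r+1}(r\sigma)=A_0Q_r((r-1)\sigma)+Q_r((r-1)\sigma)A_1$ for $r\ge 1$. Define $Z:\mathbb{R}\to\mathbb{R}^{d\times d}$ by $Z(\vartheta)=\Theta$ for $\vartheta<-\sigma$, and, for each integer $u\ge 0$ and $\vartheta\in[(u-1)\sigma,u\sigma)$, \[ Z(\vartheta)=\sum_{r=0}^{u}Q_{r+1}(r\sigma)\frac{(\vartheta-(r-1)\sigma)^r}{r!}. \] *)

(* Defs.v *)
From HB Require Import structures.
From mathcomp Require Import all_boot all_order all_algebra.
From mathcomp Require Import all_classical all_reals all_analysis.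
Set Implicit Arguments. Unset Strict Implicit. Unset Printing Implicit Defensive.
Import Order.TTheory GRing.Theory Num.Theory.
Import numFieldNormedType.Exports.
Local Open Scope classical_set_scope.
Local Open Scope ring_scope.

Section Defs.
Variable R : realType.

Definition has_deriv_within (V : normedModType R) (A : set R) (f : R -> V)
    (x : R) (l : V) : Prop :=
  (fun h : R => h^-1 *: (f (x + h) - f x))
    @ within (fun h : R => h != 0 /\ A (x + h)) (nbhs (0 : R)) --> l.

Variable d : nat.

(** Qm r = Q_{r+1}(r sigma) *)
Fixpoint Qm (A0 A1 : 'M[R]_d) (r : nat) : 'M[R]_d :=
  match r with
  | O => 1%:M
  | r'.+1 => A0 *m Qm A0 A1 r' + Qm A0 A1 r' *m A1
  end.

(** Z(theta); for theta >= -sigma, u is the unique natural number with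
    (u-1) sigma <= theta < u sigma, i.e. u = floor(theta/sigma) + 1. *)
Definition Zfun (sigma : R) (A0 A1 : 'M[R]_d) (theta : R) : 'M[R]_d :=
  if theta < - sigma then 0
  else let u : nat := absz (Num.floor (theta / sigma) + 1)%R in
    \sum_(r < u.+1)
      (((theta - (r%:R - 1) * sigma) ^+ r / (r`!)%:R) *: Qm A0 A1 r).

Definition mx_integral (a b : R) (F : R -> 'M[R]_d) : 'M[R]_d :=
  \matrix_(i, j) Rintegral (@lebesgue_measure R) `[a, b] (fun s => F s i j).

Definition Xfun (sigma : R) (A0 A1 : 'M[R]_d) (Psi dPsi : R -> 'M[R]_d)
    (theta : R) : 'M[R]_d :=
  Zfun sigma A0 A1 theta *m Psi (- sigma)
  + mx_integral (- sigma) 0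
      (fun s => Zfun sigma A0 A1 (theta - sigma - s) *m dPsi s).

End Defs.

(* Main.v *)
(** Writing [x_+^r] for the truncated power, which vanishes for [x < 0], one has
    [Z(t) = \sum_r (t - (r - 1) sigma)_+^r / r! *: Q_r], where the sum may be cut
    at any [N] with [t <= N sigma].  Hence [X(t) = \sum_r Q_r G_r(t - (r - 1) sigma)],
    where [G_r] combines [Psi(-sigma)] with the convolution of [x_+^r / r!] and
    [dPsi].  One checks [G_(r+1)' = G_r], and [G_0(t + sigma)] is [Psi(t)] on
    [[-sigma, 0]] and constant afterwards.  Differentiating termwise and using
    [Q_(r+1) = A0 Q_r + Q_r A1] together with the fact that [G_r] commutes with
    [A1] gives the equation.  The derivatives come from the Taylor remainder
    [E_r(x, h)] of [x_+^(r+1)] ([trem] below), which satisfies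
    [E_(r+1)(x, h) = (x + h) E_r(x, h) + (r + 1) h^2 x_+^r]. *)
Require Import Defs.
From HB Require Import structures.
From mathcomp Require Import all_boot all_order all_algebra.
From mathcomp Require Import all_classical all_reals all_analysis.
From mathcomp Require Import measurable_realfun ring lra.
Import Order.TTheory GRing.Theory Num.Theory.
Import numFieldNormedType.Exports.
Local Open Scope classical_set_scope.
Local Open Scope ring_scope.

(** * Truncated powers and their Taylor remainders *)

Section truncated_power.
Variable R : realType.
Implicit Types (x h M : R) (r : nat).

(** The cut is at [x < 0], so [tpow 0 0 = 1]. This right-continuous choice matches the left-closed
    pieces of Z and gives Z(-sigma) = I. *)
Definition tpow r x : R := if x < 0 then 0 else x ^+ r.

Lemma tpow_neg r x : x < 0 -> tpow r x = 0.
Proof. by rewrite /tpow => ->. Qed.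

Lemma tpow_nneg r x : 0 <= x -> tpow r x = x ^+ r.
Proof. by rewrite /tpow leNgt => /negbTE ->. Qed.

Lemma tpowS r x : tpow r.+1 x = x * tpow r x.
Proof. by rewrite /tpow; case: ifP => _; rewrite ?mulr0// exprS. Qed.

Lemma tpowS_npos r x : x <= 0 -> tpow r.+1 x = 0.
Proof.
rewrite le_eqVlt => /predU1P[->|]; last exact: tpow_neg.
by rewrite tpowS mul0r.
Qed.

Lemma ler_norm_tpow r x M : `|x| <= M -> `|tpow r x| <= M ^+ r.
Proof.
move=> xM; have M0 : 0 <= M by exact: le_trans xM.
rewrite /tpow; case: ifP => _; first by rewrite normr0 exprn_ge0.
by rewrite normrX lerXn2r// nnegrE.
Qed.

Definition trem r x h : R :=
  tpow r.+1 (x + h) - tpow r.+1 x - r.+1%:R * h * tpow r x.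

Lemma tremS r x h :
  trem r.+1 x h = (x + h) * trem r x h + r.+1%:R * h ^+ 2 * tpow r x.
Proof. by rewrite /trem !tpowS -!natr1; ring. Qed.

Lemma trem0_nneg x h : 0 <= x -> 0 <= x + h -> trem 0 x h = 0.
Proof. by move=> x0 xh0; rewrite /trem !tpow_nneg//; ring. Qed.

(** The map x_+ is affine on each side of 0, so the remainder vanishes unless [x] and [x + h] are
    separated by the kink, which forces [|x| <= |h|]. There it is only linear in [h]; the indicator
    is kept so that integrating over [x] can supply the missing factor. *)
Lemma ler_norm_trem0 x h : `|trem 0 x h| <= `|h| * (`|x| <= `|h|)%R%:R.
Proof.
rewrite /trem /tpow !expr1 expr0.
have [x0|x0] := ltP x 0; have [h0|h0] := ltP h 0.
- have -> : x + h < 0 by lra.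
  by rewrite !(subr0, mulr0) normr0 mulr_ge0.
- case: ifPn => [_|]; first by rewrite !(subr0, mulr0) normr0 mulr_ge0.
  rewrite -leNgt => xh; rewrite (ltr0_norm x0) (ger0_norm h0).
  have -> : - x <= h by lra.
  by rewrite !(subr0, mulr0) ger0_norm//= mulr1; lra.
- case: ifPn => xh.
    rewrite (ltr0_norm h0) (ger0_norm x0).
    have -> : x <= - h by lra.
    by rewrite /= !mulr1 mul1r ler_norml; apply/andP; split; lra.
  by rewrite (_ : _ - _ - _ = 0) ?normr0 ?mulr_ge0//; ring.
- have -> : x + h < 0 = false by apply/negbTE; rewrite -leNgt; lra.
  by rewrite (_ : _ - _ - _ = 0) ?normr0 ?mulr_ge0//; ring.
Qed.

(** In [tremS] the factor [x + h] is itself at most [|h|] in absolute value wherever [trem 0 x h] is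
    nonzero, so the kink costs one [h ^+ 2]. The second comes from the other term of the
    recursion. *)
Lemma ler_norm_trem1 x h : `|trem 1 x h| <= 2 * h ^+ 2.
Proof.
rewrite tremS mulr_natl [leRHS]mulr_natl mulr2n.
apply: (le_trans (ler_normD _ _)); apply: lerD.
  rewrite normrM -[leRHS]real_normK ?num_real// expr2.
  have [x0|x0] := leP 0 x; have [xh0|xh0] := leP 0 (x + h).
  - by rewrite trem0_nneg// normr0 mulr0 mulr_ge0.
  - apply: ler_pM => //; first by rewrite ltr0_norm// ltr0_norm; lra.
    by apply: (le_trans (ler_norm_trem0 _ _)); rewrite ler_piMr// lern1 leq_b1.
  - apply: ler_pM => //; first by rewrite ger0_norm// ger0_norm; lra.
    by apply: (le_trans (ler_norm_trem0 _ _)); rewrite ler_piMr// lern1 leq_b1.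
  - by rewrite /trem !tpow_neg// !(subr0, mulr0) normr0 mulr0 mulr_ge0.
rewrite mulr1n normrM ger0_norm ?sqr_ge0// ler_piMr ?sqr_ge0//.
by rewrite /tpow; case: ifP; rewrite ?normr0 ?expr0 ?normr1.
Qed.

Lemma ler_norm_tremS r M : exists C : R, forall x h, `|x| <= M -> `|h| <= 1 ->
  `|trem r.+1 x h| <= C * h ^+ 2.
Proof.
elim: r => [|r [C IH]]; first by exists 2 => x h _ _; exact: ler_norm_trem1.
(* The two summands bound the two terms of [tremS], using [|x + h| <= M + 1] and
   [|x_+^(r+1)| <= M^(r+1)]. *)
exists ((M + 1) * C + r.+2%:R * M ^+ r.+1) => x h xM h1.
rewrite tremS [leRHS]mulrDl; apply: (le_trans (ler_normD _ _)); apply: lerD.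
  rewrite normrM -mulrA; apply: ler_pM => //; last exact: IH.
  by apply: (le_trans (ler_normD _ _)); exact: lerD.
rewrite -mulrA normrM normr_nat -mulrA ler_wpM2l ?ler0n//.
rewrite mulrC normrM [`|h ^+ 2|]ger0_norm ?sqr_ge0// ler_wpM2r ?sqr_ge0//.
exact: ler_norm_tpow.
Qed.

Lemma ler_norm_trem r M : exists2 C : R, 0 <= C & forall x h, `|x| <= M -> `|h| <= 1 ->
  `|trem r x h| <= C * h ^+ 2 + `|h| * (`|x| <= `|h|)%R%:R.
Proof.
case: r => [|r].
  by exists 0 => // x h _ _; rewrite mul0r add0r; exact: ler_norm_trem0.
have [C HC] := ler_norm_tremS r M; exists `|C| => // x h xM h1.
rewrite -[leLHS]addr0; apply: lerD; last by rewrite mulr_ge0.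
by apply: (le_trans (HC _ _ xM h1)); rewrite ler_wpM2r ?sqr_ge0// ler_norm.
Qed.

Lemma measurable_tpow r : measurable_fun setT (tpow r).
Proof.
by apply: measurable_fun_ifT => //; exact: measurable_fun_ltr.
Qed.

End truncated_power.
Arguments tpow {R}.
Arguments trem {R}.

(** * Convolution of truncated powers with a continuous function *)

Lemma lebesgue_segment (R : realType) (x y : R) : x <= y ->
  (@lebesgue_measure R `[x, y] = (y - x)%:E)%E.
Proof.
rewrite lebesgue_measure_itv/= lte_fin le_eqVlt => /predU1P[->|->]//.
by rewrite ltxx subrr.
Qed.

Section truncated_convolution.
Variables (R : realType) (a b : R) (g : R -> R).
Hypothesis ab : a <= b.
Hypothesis g_continuous : {within `[a, b], continuous g}.
Implicit Types (s t h : R) (r : nat).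
Local Notation mu := (@lebesgue_measure R).

Definition conv r t : R := \int[mu]_(s in `[a, b]) (tpow r (t - s) * g s).

Lemma conv0_segment t : a <= t <= b ->
  conv 0 t = \int[@lebesgue_measure R]_(s in `[a, t]) g s.
Proof.
move=> /andP[at_ tb].
have -> : `[a, t]%classic = `[a, b]%classic `&` `]-oo, t]%classic :> set R.
  apply/seteqP; split => s /=; rewrite !in_itv/=.
    by move=> /andP[-> st]; rewrite (le_trans st).
  by move=> [/andP[-> _] ->].
rewrite Rintegral_mkcondr; apply: eq_Rintegral => s _; rewrite /patch /tpow.
case: ifPn => ts.
  rewrite memNset ?mul0r//= in_itv/=; apply/negP; rewrite -ltNge; lra.
rewrite mem_set ?expr0 ?mul1r//= in_itv/=; lra.
Qed.

Lemma conv0_ge t : b <= t -> conv 0 t = conv 0 b.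
Proof.
move=> bt; apply: eq_Rintegral => s /set_mem /=; rewrite in_itv/= => /andP[_ sb].
by rewrite !tpow_nneg// subr_ge0// (le_trans sb).
Qed.

Lemma segment_norm_bounded : exists2 K : R, 0 <= K & forall s, a <= s <= b -> `|g s| <= K.
Proof.
have := compact_bounded (continuous_compact g_continuous (@segment_compact R a b)).
move=> [M [Mreal HM]]; exists (`|M| + 1); first by rewrite addr_ge0.
move=> s sab; apply: HM; first by rewrite ltr_pwDr// ler_norm.
by exists s => //=; rewrite in_itv.
Qed.

Lemma segment_dist_le s t : a <= s <= b -> `|t - s| <= `|t| + (`|a| + `|b|).
Proof.
move=> /andP[as_ sb]; apply: (le_trans (ler_normB _ _)); rewrite lerD2l.
have [s0|s0] := leP 0 s.
  rewrite (@le_trans _ _ `|b|) ?lerDr// ger0_norm//.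
  exact: le_trans sb (ler_norm _).
rewrite (@le_trans _ _ `|a|) ?lerDl// ltr0_norm// -normrN.
by apply: le_trans (ler_norm _); rewrite lerN2.
Qed.

(** The kernel jumps when [r = 0], so integrability comes from a bounded measurable factor times the
    continuous [g]. *)
Lemma integrable_conv r t :
  mu.-integrable `[a, b] (EFin \o (fun s => tpow r (t - s) * g s)).
Proof.
apply: (@integrableMr _ _ _ mu `[a, b] _ (fun s => tpow r (t - s)) (EFin \o g)) => //.
- apply: measurable_funTS; apply: measurableT_comp; first exact: measurable_tpow.
  exact: measurable_funB.
- exists ((`|t| + (`|a| + `|b|)) ^+ r); split; first by rewrite num_real.
  move=> M /ltW rM s /=; rewrite in_itv/= => sab.
  by apply: le_trans rM; exact/ler_norm_tpow/segment_dist_le.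
- apply: continuous_compact_integrable => //; exact: segment_compact.
Qed.

Lemma conv_remE r t h :
  conv r.+1 (t + h) - conv r.+1 t - r.+1%:R * h * conv r t =
  \int[mu]_(s in `[a, b]) (trem r (t - s) h * g s).
Proof.
rewrite /conv -RintegralZl//; last exact: integrable_conv.
rewrite -RintegralB//; [|exact: integrable_conv..].
rewrite -RintegralB//.
- apply: eq_Rintegral => s _; rewrite /trem (_ : t + h - s = t - s + h); last by ring.
  by ring.
- by apply: (integrableB _ (integrable_conv r.+1 (t + h)) (integrable_conv r.+1 t)).
- by apply: (integrableZl _ (r.+1%:R * h) (integrable_conv r t)).
Qed.

Lemma integrable_trem r t h :
  mu.-integrable `[a, b] (EFin \o (fun s => trem r (t - s) h * g s)).
Proof.
have H : mu.-integrable `[a, b] (fun s =>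
  (tpow r.+1 (t + h - s) * g s)%:E - (tpow r.+1 (t - s) * g s)%:E
   - ((r.+1%:R * h)%:E * (tpow r (t - s) * g s)%:E))%E.
  apply: integrableB => //; last by apply: integrableZl => //; exact: integrable_conv.
  by apply: integrableB => //; exact: integrable_conv.
apply: eq_integrable H => // s _ /=.
congr EFin.
by rewrite /trem (_ : t + h - s = t - s + h); ring.
Qed.

(** Convolution smooths the kink: the part of the remainder that is only linear in [h] lives on a
    window of length [2 * |h|], so its integral is again quadratic. Hence no restriction on [t],
    even for [r = 0]. *)
Lemma conv_rem_le r t : exists C : R, forall h, `|h| <= 1 ->
  `|conv r.+1 (t + h) - conv r.+1 t - r.+1%:R * h * conv r t| <= C * h ^+ 2.
Proof.
have [K K0 HK] := segment_norm_bounded.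
have [C C0 HC] := ler_norm_trem _ r (`|t| + (`|a| + `|b|)).
exists (C * K * (b - a) + 2 * K) => h h1; rewrite conv_remE.
apply: (le_trans (le_normr_Rintegral _ _)) => //; first exact: integrable_trem.
(* [J] is the set where [|t - s| <= |h|], the only place where the kink term survives. It yields
   [2 * K] in the constant, and the quadratic term yields [C * K * (b - a)]. *)
pose J := `[t - `|h|, t + `|h|]%classic : set R.
have iJ : mu.-integrable `[a, b] (EFin \o (fun s => K * `|h| * \1_J s)).
  apply: (@integrableZl _ _ _ mu `[a, b] _ (K * `|h|) (EFin \o \1_J)) => //.
  apply: (@integrableS _ _ _ mu setT) => //.
  exact: integrable_indic_itv.
have ic c : mu.-integrable `[a, b] (EFin \o (fun _ : R => c : R)).
  apply: continuous_compact_integrable; first exact: segment_compact.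
  by move=> x; exact: cvg_cst.
apply: (@le_trans _ _ (\int[mu]_(s in `[a, b]) (C * h ^+ 2 * K + K * `|h| * \1_J s))).
  apply: le_Rintegral => //.
  - by apply: integrable_norm; exact: integrable_trem.
  - by apply: (integrableD _ (ic (C * h ^+ 2 * K)) iJ).
  move=> s /=; rewrite in_itv/= => sab.
  have -> : \1_J s = (`|t - s| <= `|h|)%R%:R :> R.
    rewrite indicE; congr ((_ : bool)%:R); apply/idP/idP.
      by rewrite inE /J /= in_itv/= => /andP[? ?]; rewrite ler_distlC; lra.
    by rewrite inE /J /= in_itv/= ler_distlC => /andP[? ?]; lra.
  rewrite normrM (_ : _ + _ = (C * h ^+ 2 + `|h| * (`|t - s| <= `|h|)%R%:R) * K);
    last by ring.
  by apply: ler_pM => //; [apply: HC => //; exact: segment_dist_le | exact: HK].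
rewrite RintegralD// Rintegral_cst// RintegralZl//; last first.
  apply: (@integrableS _ _ _ mu setT) => //.
  exact: integrable_indic_itv.
rewrite [leRHS]mulrDl; apply: lerD.
  rewrite (_ : fine _ = b - a); last by apply: (congr1 fine (lebesgue_segment _ _ _ ab)).
  by rewrite le_eqVlt; apply/orP; left; apply/eqP; ring.
rewrite (_ : 2 * K * _ = K * `|h| * (2 * `|h|)); last first.
  by rewrite -[h ^+ 2]real_normK ?num_real//; ring.
rewrite ler_wpM2l ?mulr_ge0// /Rintegral integral_indic//=; last exact: measurable_itv.
have muJ : mu J = (2 * `|h|)%:E.
  rewrite /J lebesgue_segment; last by have := normr_ge0 h; lra.
  by congr EFin; ring.
have mJab : measurable (J `&` `[a, b]) by apply: measurableI; exact: measurable_itv.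
have leJ : (mu (J `&` `[a, b]) <= (2 * `|h|)%:E)%E.
  by rewrite -muJ; apply: le_measure; rewrite ?inE//; exact: measurable_itv.
rewrite -lee_fin fineK// ge0_fin_numE//; exact: le_lt_trans leJ (ltry _).
Qed.

End truncated_convolution.

(** * Derivatives relative to a set and the fundamental theorem of calculus *)

Section derivative_within.
Variable R : realType.
Implicit Types (A : set R) (x h : R).

(* A quadratic remainder bound is stronger than differentiability, but it adds
   up over finite sums without any filter reasoning. *)
Definition quad_deriv A (f : R -> R) x l : Prop :=
  exists C : R, forall h, `|h| <= 1 -> A (x + h) ->
    `|f (x + h) - f x - h * l| <= C * h ^+ 2.

Lemma quad_deriv_sum A (I : finType) (c : I -> R) (f : I -> R -> R) x l :
  (forall i, quad_deriv A (f i) x (l i)) ->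
  quad_deriv A (fun y => \sum_i c i * f i y) x (\sum_i c i * l i).
Proof.
move=> /choice[C HC]; exists (\sum_i `|c i| * C i) => h h1 Ah.
rewrite mulr_sumr -!sumrB mulr_suml.
apply: (le_trans (ler_norm_sum _ _ _)); apply: ler_sum => i _.
rewrite (_ : _ - _ = c i * (f i (x + h) - f i x - h * l i)); last by ring.
by rewrite normrM -mulrA ler_wpM2l// HC.
Qed.

(** Dividing the quadratic bound by [h] leaves an error [C * |h|] in each entry, and there are
    finitely many entries. *)
Lemma has_deriv_within_mx A (m : nat) (f : R -> 'M[R]_m) x (l : 'M[R]_m) :
  (forall i j, quad_deriv A (fun y => f y i j) x (l i j)) ->
  has_deriv_within A f x l.
Proof.
move=> H; rewrite /has_deriv_within.
set F := within _ _; have FF : Filter F by exact: within_filter.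
move=> S [P HP PS].
suff : \forall h \near F, forall ij : 'I_m * 'I_m,
    P ij.1 ij.2 ((h^-1 *: (f (x + h) - f x)) ij.1 ij.2).
  by move=> {}H; apply: filterS H => h Hh; apply: PS => i j; exact: (Hh (i, j)).
apply: filter_forall => -[i j] /=.
suff : (fun h => (h^-1 *: (f (x + h) - f x)) i j) @ F --> (l i j : R).
  by move=> /(_ _ (HP i j)).
have [C HC] := H i j.
apply/cvgrPdist_le => /= e e0; rewrite /F near_withinE.
near=> h => -[h0 Ah].
have h1 : `|h| <= 1 by near: h; exact: (@nbhs0_le R R).
have he : `|h| <= e / (`|C| + 1) by near: h; apply: (@nbhs0_le R R); rewrite divr_gt0// ltr_wpDl.
rewrite !mxE distrC.
rewrite (_ : _ - _ = h^-1 * (f (x + h) i j - f x i j - h * l i j)); last by field.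
rewrite normrM normfV ler_pdivrMl ?normr_gt0//.
apply: (le_trans (HC _ h1 Ah)).
rewrite -[h ^+ 2]real_normK ?num_real// expr2 mulrCA ler_wpM2l//.
move: he; rewrite ler_pdivlMr ?ltr_wpDl//; apply: le_trans.
rewrite mulrC ler_wpM2l//.
by rewrite (le_trans (ler_norm _))// lerDl.
Unshelve. all: by end_near. Qed.

Lemma has_deriv_within_coord A (m : nat) (f : R -> 'M[R]_m) x (l : 'M[R]_m) i j :
  has_deriv_within A f x l ->
  has_deriv_within A (fun y => f y i j : R) x (l i j).
Proof.
move=> H; rewrite /has_deriv_within.
rewrite (_ : (fun h => _) = fun h => (h^-1 *: (f (x + h) - f x)) i j).
  apply: (@continuous_cvg _ _ _ _ _ _ (fun M : 'M[R]_m => M i j)) H.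
  exact: coord_continuous.
by apply/funext => h; rewrite !mxE.
Qed.

(** Near [x] the difference quotient is within 1 of [l], so [|f y - f x| <= (|l| + 1) * |y - x|] on
    [A]. *)
Lemma has_deriv_within_cvg A (f : R -> R) x l : A x ->
  has_deriv_within A f x l -> f @ within A (nbhs x) --> f x.
Proof.
move=> Ax /cvgrPdist_le /(_ 1 ltr01); rewrite near_withinE => H.
apply/cvgrPdist_le => e e0; rewrite near_withinE.
have {}H : \forall y \near x, y - x != 0 /\ A (x + (y - x)) ->
    `|l - (y - x)^-1 *: (f (x + (y - x)) - f x)| <= 1.
  have : (fun y => y - x) @ x --> (0 : R).
    by rewrite -(subrr x); apply: cvgB; [exact: cvg_id|exact: cvg_cst].
  by move=> /(_ _ H).
near=> y => Ay.
have [->|yx] := eqVneq y x; first by rewrite subrr normr0 ltW.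
have yx0 : y - x != 0 by rewrite subr_eq0.
have : y - x != 0 /\ A (x + (y - x)) ->
    `|l - (y - x)^-1 *: (f (x + (y - x)) - f x)| <= 1 by near: y.
rewrite [x + (y - x)]addrC subrK => /(_ (conj yx0 Ay)) q1.
have he : `|y - x| <= e / (`|l| + 1).
  rewrite distrC; near: y; apply: cvgr_dist_le; first exact: cvg_id.
  by rewrite divr_gt0// ltr_wpDl.
rewrite distrC (_ : _ - _ = (y - x) * ((y - x)^-1 *: (f y - f x))); last first.
  by rewrite /GRing.scale/=; field.
move: he; rewrite ler_pdivlMr ?ltr_wpDl//; apply: le_trans.
rewrite normrM ler_wpM2l// -lerBlDl.
by rewrite (le_trans (lerB_dist _ _))// distrC.
Unshelve. all: by end_near. Qed.

(** Reduction to [continuous_FTC2]: at interior points small increments stay in [[a, b]], so the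
    relative derivative is the ordinary one, and at the two ends relative continuity gives the
    one-sided limits. *)
Lemma continuous_FTC2_within (a b : R) (f g : R -> R) y :
  a <= y <= b ->
  (forall x, a <= x <= b -> has_deriv_within `[a, b] f x (g x)) ->
  {within `[a, b], continuous g} ->
  \int[@lebesgue_measure R]_(s in `[a, y]) g s = f y - f a.
Proof.
move=> /andP[ay yb] df cg.
move: ay; rewrite le_eqVlt => /predU1P[<-|ay].
  by rewrite set_itv1 Rintegral_set1 subrr.
have cf x : a <= x <= b -> f @ within `[a, b] (nbhs x) --> f x.
  by move=> xab; apply: has_deriv_within_cvg (df _ xab); rewrite /= in_itv.
have dfo x : x \in `]a, y[ -> is_derive x 1 f (g x).
  rewrite in_itv/= => /andP[ax xy].
  have xab : a <= x <= b by rewrite (ltW ax) (le_trans (ltW xy)).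
  have H : h^-1 *: (f (h *: 1 + x) - f x) @[h --> 0^'] --> g x.
    have := df x xab; rewrite /has_deriv_within => H.
    apply: cvg_trans H => S HS.
    have {}HS : \forall h \near (0 : R),
      h != 0 /\ x + h \in `[a, b] -> S (h^-1 *: (f (x + h) - f x)) by exact: HS.
    suff : \forall h \near (0 : R), h != 0 -> S (h^-1 *: (f (h *: 1 + x) - f x)) by [].
    near=> h => h0.
    have -> : h *: 1 + x = x + h by rewrite /GRing.scale/= mulr1 addrC.
    have : `|h| < b - x by near: h; apply: (@nbhs0_lt R R); rewrite subr_gt0 (lt_le_trans xy).
    have : `|h| < x - a by near: h; apply: (@nbhs0_lt R R); rewrite subr_gt0.
    rewrite !ltr_norml => /andP[hl _] /andP[_ hr].
    have abh : x + h \in `[a, b] by rewrite in_itv/=; apply/andP; split; lra.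
    have HSh : h != 0 /\ x + h \in `[a, b] -> S (h^-1 *: (f (x + h) - f x)) by near: h.
    exact: HSh.
  by split; [apply/cvg_ex; exists (g x) | exact: cvg_lim].
rewrite /Rintegral (@continuous_FTC2 _ g f a y)//.
- by apply: continuous_subspaceW cg; apply: subset_itvl; rewrite bnd_simp.
- split.
  + by move=> x xay; have [] := dfo x xay.
  + apply: cvg_trans (cf a _); last by rewrite lexx (le_trans (ltW ay)).
    apply: cvg_app => S HS.
    have {}HS : \forall z \near a, z \in `[a, b] -> S z by exact: HS.
    suff : \forall z \near a, a < z -> S z by [].
    near=> z => az; have HSz : z \in `[a, b] -> S z by near: z.
    apply: HSz; rewrite /= in_itv/= ltW//=; apply: ltW; near: z.
    by apply: lt_nbhsl; exact: lt_le_trans yb.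
  + apply: cvg_trans (cf y _); last by rewrite ltW.
    apply: cvg_app => S HS.
    have {}HS : \forall z \near y, z \in `[a, b] -> S z by exact: HS.
    suff : \forall z \near y, z < y -> S z by [].
    near=> z => zy; have HSz : z \in `[a, b] -> S z by near: z.
    apply: HSz; rewrite /= in_itv/= (le_trans (ltW zy) yb) andbT; apply: ltW; near: z.
    exact: lt_nbhsr.
- by move=> x xay; rewrite derive1E; have [] := dfo x xay.
Unshelve. all: by end_near. Qed.
End derivative_within.

(** * Commutation with a fixed matrix passes to the derivative *)

Section matrix_derivative.
Variable R : realType.

(** Properness is what makes limits of difference quotients unique. From the left half of the
    segment one steps right, from the right half left, by at most half its length. *)
Lemma segment_within_proper (a b x : R) : a < b -> a <= x <= b ->
  ProperFilter (within (fun h : R => h != 0 /\ `[a, b]%classic (x + h)) (nbhs (0 : R))).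
Proof.
move=> ab /andP[ax xb]; apply: Build_ProperFilter_ex => P FP.
have {FP} : \forall h \near (0 : R), h != 0 /\ x + h \in `[a, b] -> P h by exact: FP.
move=> /nbhs_ballP[e /= e0 eP].
have e2 : 0 < e / 2 by rewrite divr_gt0.
pose k := Num.min (e / 2) ((b - a) / 2).
have k0 : 0 < k by rewrite lt_min e2 divr_gt0// subr_gt0.
have ke : k <= e / 2 by rewrite ge_min lexx.
have kab : k <= (b - a) / 2 by rewrite ge_min lexx orbT.
have ball_k h : `|h| = k -> ball (0 : R) e h.
  by move=> hk; rewrite -ball_normE /ball_/= sub0r normrN hk; lra.
have [xm|xm] := leP x ((a + b) / 2).
  exists k; apply: eP; first by apply: ball_k; rewrite gtr0_norm.
  by split; [rewrite gt_eqF|rewrite in_itv/=; apply/andP; split; lra].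
exists (- k); apply: eP; first by apply: ball_k; rewrite normrN gtr0_norm.
by split; [rewrite oppr_eq0 gt_eqF|rewrite in_itv/=; apply/andP; split; lra].
Qed.

(** Multiplying the difference quotients of [f] by [B] on either side gives the same matrix, so the
    limits [B *m l] and [l *m B] coincide. *)
Lemma has_deriv_within_comm (m : nat) (a b x : R) (B l : 'M[R]_m) (f : R -> 'M[R]_m) :
  a < b -> a <= x <= b ->
  (forall y, a <= y <= b -> B *m f y = f y *m B) ->
  has_deriv_within `[a, b] f x l -> B *m l = l *m B.
Proof.
move=> ab xab fB df; apply/matrixP => i j; rewrite !mxE.
have PF := segment_within_proper a b x ab xab.
set F := within _ _ in PF.
have dfE i' j' : h^-1 * (f (x + h) i' j' - f x i' j') @[h --> F] --> l i' j'.
  exact: (has_deriv_within_coord _ _ _ _ _ _ i' j' df).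
have sumE (c : 'I_m -> R) (u : 'I_m -> 'I_m * 'I_m) :
    \sum_k c k * (h^-1 * (f (x + h) (u k).1 (u k).2 - f x (u k).1 (u k).2)) @[h --> F]
    --> \sum_k c k * l (u k).1 (u k).2.
  apply: (cvg_big add_continuous) => k _.
  by apply: cvgM; [exact: cvg_cst | exact: dfE].
have := sumE (fun k => B i k) (fun k => (k, j)) => /= H1.
have := sumE (fun k => B k j) (fun k => (i, k)) => /= H2.
rewrite [RHS](eq_bigr (fun k => B k j * l i k)); last by move=> k _; rewrite mulrC.
suff H3 : \sum_k B i k * (h^-1 * (f (x + h) k j - f x k j)) @[h --> F]
    --> \sum_k B k j * l i k.
  by rewrite -(cvg_lim (@norm_hausdorff R R) H1) -(cvg_lim (@norm_hausdorff R R) H3).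
apply: cvg_trans H2; apply: near_eq_cvg; rewrite /F near_withinE; near=> h => -[h0].
rewrite /= in_itv/= => xh.
have /matrixP/(_ i j) := fB _ xh; rewrite !mxE => E1.
have /matrixP/(_ i j) := fB _ xab; rewrite !mxE => E2.
transitivity (h^-1 * (\sum_k f (x + h) i k * B k j - \sum_k f x i k * B k j)).
  by rewrite -sumrB mulr_sumr; apply: eq_bigr => k _; ring.
rewrite -E1 -E2 -sumrB mulr_sumr; apply: eq_bigr => k _; ring.
Unshelve. all: by end_near. Qed.

End matrix_derivative.

(** * Finite sums under the integral, and Z as a sum of truncated powers *)

Lemma Rintegral_sum (disp : measure_display) (T : measurableType disp) (R : realType)
    (mu : {measure set T -> \bar R}) (D : set T) (I : finType) (f : I -> T -> R) :
  measurable D -> (forall i, mu.-integrable D (EFin \o f i)) ->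
  \int[mu]_(s in D) (\sum_i f i s) = \sum_i \int[mu]_(s in D) f i s.
Proof.
move=> mD fi; rewrite /Rintegral.
under eq_integral do rewrite -sumEFin.
rewrite (integral_sum mD fi) -[RHS]/(fine (_%:E)) -sumEFin; congr fine.
by apply: eq_bigr => i _; rewrite fineK//; exact: (integrable_fin_num mD (fi i)).
Qed.

(** This trades the cut-off depending on [theta] for one [N] valid on a whole half-line, so that
    sums at different points can be compared termwise. *)
Lemma Zfun_tpow (R : realType) (d : nat) (sigma theta : R) (A0 A1 : 'M[R]_d) (N : nat) :
  0 < sigma -> theta <= N%:R * sigma ->
  Zfun sigma A0 A1 theta =
  \sum_(r < N.+1) (tpow r (theta - (r%:R - 1) * sigma) / r`!%:R) *: Qm A0 A1 r.
Proof.
move=> s0 thN; rewrite /Zfun; case: ifPn => [th|].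
  rewrite big1// => r _; rewrite tpow_neg ?mul0r ?scale0r//.
  have : 0 <= (r : nat)%:R * sigma by rewrite mulr_ge0// ltW.
  lra.
rewrite -leNgt => th.
have /andP[] := floor_itv (theta / sigma).
rewrite ler_pdivlMr// ltr_pdivrMr//.
have fl0 : 0 <= Num.floor (theta / sigma) + 1.
  by rewrite -lerBlDr sub0r floor_ge_int ler_pdivlMr// mulN1r.
set w := Num.floor _ + 1 in fl0 *.
rewrite (_ : Num.floor _ = w - 1); last by rewrite addrK.
case: w fl0 => // u _ /=; rewrite rmorphB/= => th1 th2.
pose F r := (tpow r (theta - (r%:R - 1) * sigma) / r`!%:R) *: Qm A0 A1 r.
(* Both cut-offs are compared with [minn u N]: beyond it the exponent is positive and
   [theta <= (r - 1) * sigma], so the truncated power vanishes. *)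
have F0 r : (minn u N < r)%N -> F r = 0.
  case: r => // r; rewrite ltnS geq_min => /orP[|] ur.
    rewrite /F tpowS_npos ?mul0r ?scale0r// -natr1 addrK subr_le0.
    apply: (le_trans (ltW th2)); rewrite ler_wpM2r ?(ltW s0)//.
    by rewrite ler_nat.
  rewrite /F tpowS_npos ?mul0r ?scale0r// -natr1 addrK subr_le0.
  by apply: (le_trans thN); rewrite ler_wpM2r ?(ltW s0)// ler_nat.
have FE n : (minn u N <= n)%N -> \sum_(r < n.+1) F r = \sum_(r < (minn u N).+1) F r.
  move=> un; rewrite [RHS](big_ord_widen n.+1 F)// [RHS]big_mkcond/=.
  by apply: eq_bigr => r _; case: ifPn => //; rewrite -leqNgt => /F0.
transitivity (\sum_(r < u.+1) F r); last first.
  by rewrite -[RHS]/(\sum_(r < N.+1) F r) !FE// ?geq_minl ?geq_minr.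
apply: eq_bigr => r _; rewrite /F tpow_nneg// subr_ge0.
apply: le_trans th1; rewrite ler_wpM2r ?(ltW s0)// lerB//.
by rewrite -[leRHS]/(u%:R) ler_nat -ltnS.
Qed.

(** * Expansion of X and properties of its components G_r *)

Section delay_equation.
Variables (R : realType) (d : nat) (sigma : R) (A0 A1 : 'M[R]_d).
Variables Psi dPsi : R -> 'M[R]_d.
Hypothesis sigma_gt0 : 0 < sigma.
Hypothesis Psi_deriv : forall x, - sigma <= x <= 0 ->
  has_deriv_within `[- sigma, 0] Psi x (dPsi x).
Hypothesis dPsi_continuous : {within `[- sigma, 0], continuous dPsi}.
Hypothesis Psi_comm : forall x, - sigma <= x <= 0 -> A1 *m Psi x = Psi x *m A1.
Implicit Types (r N : nat) (t x : R).
Local Notation X := (Xfun sigma A0 A1 Psi dPsi).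
Local Notation Q := (Qm A0 A1).
Local Notation convd k j := (conv R (- sigma) 0 (fun s => dPsi s k j)).

(* The contribution of [Psi] to [X] through the [r]-th truncated power, whose
   coefficient is [Q_(r+1)(r sigma)]: see [Xfun_Gmx]. *)
Definition Gmx r t : 'M[R]_d :=
  \matrix_(k, j) ((tpow r t * Psi (- sigma) k j + convd k j r (t - sigma)) / r`!%:R).

Let Nsigma_le0 : - sigma <= 0. Proof. by rewrite oppr_le0 ltW. Qed.

Lemma dPsi_coord_continuous k j :
  {within `[- sigma, 0], continuous (fun s => dPsi s k j)}.
Proof.
move=> s; apply: (@continuous_comp _ _ _ _ (fun M : 'M[R]_d => M k j)).
  exact: dPsi_continuous.
exact: coord_continuous.
Qed.

Lemma integrable_convd k j r t : (@lebesgue_measure R).-integrable `[- sigma, 0]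
  (EFin \o (fun s => tpow r (t - s) * dPsi s k j)).
Proof. exact/integrable_conv/dPsi_coord_continuous. Qed.

Lemma integrable_convdZ c k j r t : (@lebesgue_measure R).-integrable `[- sigma, 0]
  (EFin \o (fun s => c * (tpow r (t - s) * dPsi s k j))).
Proof.
by apply: (integrableZl _ c (integrable_convd k j r t)).
Qed.

(** For [s] in [[- sigma, 0]] the argument [x - sigma - s] is at most [x], so the same [N] expands Z
    under the integral for every [s], and the finite sum can be taken out. *)
Lemma Xfun_Gmx N x : x <= N%:R * sigma ->
  X x = \sum_(r < N.+1) Q r *m Gmx r (x - (r%:R - 1) * sigma).
Proof.
move=> xN; apply/matrixP => i j; rewrite /Xfun !mxE.
pose c (p : 'I_N.+1 * 'I_d) : R := Q p.1 i p.2 / (p.1 : nat)`!%:R.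
rewrite [X in _ + X](_ : _ = \sum_(p : 'I_N.+1 * 'I_d)
    c p * convd p.2 j p.1 (x - (p.1 : nat)%:R * sigma)); last first.
  transitivity (\int[@lebesgue_measure R]_(s in `[- sigma, 0])
      (\sum_(p : 'I_N.+1 * 'I_d)
        c p * (tpow p.1 (x - (p.1 : nat)%:R * sigma - s) * dPsi s p.2 j))).
    apply: eq_Rintegral => s /set_mem /=; rewrite in_itv/= => /andP[s1 s0].
    rewrite (Zfun_tpow _ _ _ _ _ _ N)//; last first.
      by apply: le_trans xN; lra.
    rewrite mulmx_suml summxE -(pair_bigA _ (fun (r : 'I_N.+1) (k : 'I_d) => c (r, k) *
      (tpow r (x - (r : nat)%:R * sigma - s) * dPsi s k j)))/=.
    apply: eq_bigr => r _; rewrite -scalemxAl !mxE mulr_sumr; apply: eq_bigr => k _.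
    rewrite /c/= (_ : x - sigma - s - (r%:R - 1) * sigma = x - r%:R * sigma - s); last by ring.
    by ring.
  rewrite Rintegral_sum//; last first.
    by move=> p; exact: integrable_convdZ.
  apply: eq_bigr => p _; rewrite RintegralZl//; exact: integrable_convd.
rewrite (Zfun_tpow _ _ _ _ _ _ N)// summxE.
rewrite -(pair_bigA _ (fun (r : 'I_N.+1) (k : 'I_d) =>
  c (r, k) * convd k j r (x - (r : nat)%:R * sigma)))/=.
rewrite (eq_bigr (fun k => \sum_(r < N.+1) c (r, k) *
   (tpow r (x - (r%:R - 1) * sigma) * Psi (- sigma) k j))); last first.
  move=> k _; rewrite summxE mulr_suml; apply: eq_bigr => r _.
  by rewrite !mxE /c/=; ring.
rewrite exchange_big/= -big_split/=; apply: eq_bigr => r _.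
rewrite mxE -big_split/=; apply: eq_bigr => k _; rewrite mxE /c/=.
rewrite (_ : x - (r%:R - 1) * sigma - sigma = x - r%:R * sigma); last by ring.
by ring.
Qed.

(** [Gmx r t] is built from [Psi (- sigma)] and the values of [dPsi] with scalar weights; [dPsi]
    inherits commutation with [A1] from [Psi]. *)
Lemma Gmx_comm r t : A1 *m Gmx r t = Gmx r t *m A1.
Proof.
have cd s : - sigma <= s <= 0 -> A1 *m dPsi s = dPsi s *m A1.
  move=> s0; apply: (has_deriv_within_comm _ _ (- sigma) 0 s _ _ Psi) => //.
  - by rewrite oppr_lt0.
  - exact: Psi_deriv.
apply/matrixP => i j; rewrite !mxE.
pose f (c : R) k l s := c * (tpow r (t - sigma - s) * dPsi s k l).
have fi c k l : (@lebesgue_measure R).-integrable `[- sigma, 0] (EFin \o f c k l).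
  exact: integrable_convdZ.
have fE c k l : c * convd k l r (t - sigma) =
    \int[@lebesgue_measure R]_(s in `[- sigma, 0]) f c k l s.
  by rewrite RintegralZl//; exact: integrable_convd.
have Ns : - sigma <= - sigma <= 0 by rewrite lexx.
have /matrixP/(_ i j) := Psi_comm _ Ns; rewrite !mxE => cP.
transitivity ((tpow r t * (\sum_k A1 i k * Psi (- sigma) k j)
   + \sum_k A1 i k * convd k j r (t - sigma)) / r`!%:R).
  rewrite mulr_sumr -big_split/= mulr_suml; apply: eq_bigr => k _.
  by rewrite mxE; ring.
transitivity ((tpow r t * (\sum_k Psi (- sigma) i k * A1 k j)
   + \sum_k A1 k j * convd i k r (t - sigma)) / r`!%:R); last first.
  rewrite mulr_sumr -big_split/= mulr_suml; apply: eq_bigr => k _.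
  by rewrite mxE; ring.
congr ((_ + _) / _); first by rewrite cP.
under eq_bigr do rewrite fE; under [RHS]eq_bigr do rewrite fE.
rewrite -!Rintegral_sum//.
apply: eq_Rintegral => s /set_mem /=; rewrite in_itv/= => s0.
have /matrixP/(_ i j) := cd _ s0; rewrite !mxE => cds.
transitivity (tpow r (t - sigma - s) * \sum_k A1 i k * dPsi s k j).
  by rewrite mulr_sumr; apply: eq_bigr => k _; rewrite /f; ring.
by rewrite cds mulr_sumr; apply: eq_bigr => k _; rewrite /f; ring.
Qed.

(** The convolution with the step function is the integral of [dPsi] from [- sigma] to [x], so this
    is the fundamental theorem of calculus. *)
Lemma Gmx0_segment x : - sigma <= x <= 0 -> Gmx 0 (x + sigma) = Psi x.
Proof.
move=> x0; apply/matrixP => k j; rewrite mxE fact0 divr1 addrK.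
rewrite tpow_nneg ?expr0 ?mul1r; last by case/andP: x0; lra.
rewrite conv0_segment// (continuous_FTC2_within _ _ 0 (fun s => Psi s k j))//.
- by ring.
- by move=> y y0; apply: has_deriv_within_coord; exact: Psi_deriv.
- exact: dPsi_coord_continuous.
Qed.

(** The step function has already swept the whole support of the integral, so the term of index 0
    drops out of the derivative of X. *)
Lemma Gmx0_nneg x : 0 <= x -> Gmx 0 (x + sigma) = Gmx 0 sigma.
Proof.
move=> x0; apply/matrixP => k j; rewrite !mxE addrK subrr conv0_ge//.
by rewrite !tpow_nneg ?expr0// ?addr_ge0// ltW.
Qed.

(* The side condition for [r = 0] is due to the kink of [tpow 1] at the origin. *)
Lemma Gmx_quad_deriv (A : set R) r c x k j :
  (0 < r)%N \/ (c <= x /\ forall y, A y -> c <= y) ->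
  quad_deriv R A (fun y => Gmx r.+1 (y - c) k j) x (Gmx r (x - c) k j).
Proof.
move=> rc.
have [C1 HC1] : exists C : R, forall h, `|h| <= 1 -> A (x + h) ->
    `|trem r (x - c) h| <= C * h ^+ 2.
  case: rc => [|[cx cA]].
    case: r => // r _; have [C HC] := ler_norm_tremS _ r `|x - c|.
    by exists C => h h1 _; exact: HC.
  case: r => [|r].
    exists 0 => h h1 /cA ch; rewrite mul0r trem0_nneg ?normr0//; lra.
  have [C HC] := ler_norm_tremS _ r `|x - c|.
  by exists C => h h1 _; exact: HC.
have [C2 HC2] := conv_rem_le _ _ _ _ Nsigma_le0 (dPsi_coord_continuous k j) r (x - c - sigma).
exists ((C1 * `|Psi (- sigma) k j| + C2) / r.+1`!%:R) => h h1 Ah.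
rewrite !mxE (_ : x + h - c = x - c + h); last by ring.
rewrite (_ : x - c + h - sigma = x - c - sigma + h); last by ring.
have f0 : r.+1`!%:R != 0 :> R by rewrite pnatr_eq0 -lt0n fact_gt0.
have f1 : r`!%:R != 0 :> R by rewrite pnatr_eq0 -lt0n fact_gt0.
have fE : r.+1`!%:R = r.+1%:R * r`!%:R :> R by rewrite factS natrM.
have r0 : r.+1%:R != 0 :> R by rewrite pnatr_eq0.
set u := conv _ _ _ _ _ _; set v := conv _ _ _ _ _ _; set w := conv _ _ _ _ _ _.
(* Since (r+1)! = (r+1) r!, the error splits into a Taylor remainder weighted by [Psi (- sigma)] and
   the convolution error. *)
rewrite (_ : _ - _ - _ = (trem r (x - c) h * Psi (- sigma) k j
   + (u - v - r.+1%:R * h * w)) / r.+1`!%:R); last first.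
  rewrite /trem fE; move: (tpow _ _) (tpow _ _) (tpow _ _) => p1 p2 p3.
  move: r0 f1; move: (r.+1%:R) (r`!%:R) => q z q0 z0.
  by field; rewrite q0 z0.
rewrite normrM normfV normr_nat [leRHS]mulrAC ler_wpM2r ?invr_ge0 ?ler0n//.
apply: (le_trans (ler_normD _ _)); rewrite [leRHS]mulrDl; apply: lerD; last exact: HC2.
by rewrite normrM [leRHS]mulrAC ler_wpM2r// HC1.
Qed.

End delay_equation.

(** * The initial condition and the delay equation *)

Theorem theorem4 (R : realType) (d : nat) (sigma : R) (A0 A1 : 'M[R]_d)
    (Psi dPsi : R -> 'M[R]_d) :
  (0 < d)%N -> 0 < sigma -> A0 *m A1 != A1 *m A0 ->
  (forall x, - sigma <= x <= 0 ->
     has_deriv_within `[- sigma, 0] Psi x (dPsi x)) ->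
  {within `[- sigma, 0], continuous dPsi} ->
  (forall x, - sigma <= x <= 0 -> A1 *m Psi x = Psi x *m A1) ->
  (forall x, - sigma <= x <= 0 -> Xfun sigma A0 A1 Psi dPsi x = Psi x) /\
  (forall x, 0 <= x ->
     has_deriv_within `[0, +oo[ (Xfun sigma A0 A1 Psi dPsi) x
       (A0 *m Xfun sigma A0 A1 Psi dPsi (x - sigma)
        + Xfun sigma A0 A1 Psi dPsi (x - sigma) *m A1)).
Proof.
move=> _ s0 _ dP cdP cP.
pose G := Gmx R d sigma Psi dPsi.
have XG N x : x <= N%:R * sigma -> Xfun sigma A0 A1 Psi dPsi x =
    \sum_(r < N.+1) Qm A0 A1 r *m G r (x - (r%:R - 1) * sigma).
  exact: Xfun_Gmx.
split=> [x /andP[sx x0]|x x0].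
  rewrite (XG 0%N) ?mul0r// big_ord1 mul1mx -(Gmx0_segment R d sigma Psi dPsi dP cdP)//.
    by rewrite /= sub0r mulN1r opprK.
  by rewrite sx.
(* The margin 1 covers every [x + h] with [|h| <= 1], so one finite expansion serves all the
   increments tested by [quad_deriv]. *)
pose N := Num.bound ((x + 1) / sigma).
have xN : x + 1 <= N%:R * sigma.
  rewrite -ler_pdivrMr//; apply/ltW/archi_boundP.
  by rewrite divr_ge0 ?addr_ge0// ltW.
apply: has_deriv_within_mx => i j.
(* Termwise derivatives: G_(r+1)(y - r sigma) gives G_r(x - r sigma), and the term of index 0 is
   constant on the half-line. The shift lowers the index by one, hence [N.+2] terms for X near [x]
   against [N.+1] for X at [x - sigma]. *)
pose l (p : 'I_N.+2 * 'I_d) : R :=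
  if p.1 : nat is r.+1 then G r (x - r%:R * sigma) p.2 j else 0.
pose f (p : 'I_N.+2 * 'I_d) (y : R) : R := G p.1 (y - (p.1%:R - 1) * sigma) p.2 j.
have H p : quad_deriv R `[0, +oo[%classic (f p) x (l p).
  case: p => -[[|r] rN] k; rewrite /f /l /=.
    exists 0 => h _; rewrite /= in_itv/= andbT => xh.
    rewrite !sub0r !mulN1r !opprK /G !Gmx0_nneg//.
    by rewrite subrr mulr0 subr0 normr0 mul0r.
  rewrite -[X in (X - 1) * _]natr1 addrK.
  (* Only G_1 meets the kink; its centre is 0, the left end of the half-line. *)
  apply: Gmx_quad_deriv => //; case: r {rN} => [|r]; [right|by left].
  by rewrite mul0r; split => // y; rewrite /= in_itv/= andbT.
have := quad_deriv_sum R `[0, +oo[%classic _ (fun p : 'I_N.+2 * 'I_d => Qm A0 A1 p.1 i p.2) f x l H.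
move=> [C HC].
have XE y : y <= x + 1 -> Xfun sigma A0 A1 Psi dPsi y i j =
   \sum_(p : 'I_N.+2 * 'I_d) Qm A0 A1 p.1 i p.2 * f p y.
  move=> yx; rewrite (XG N.+1); last first.
    apply: (le_trans yx); apply: (le_trans xN).
    by rewrite ler_wpM2r ?(ltW s0)// ler_nat.
  rewrite summxE -(pair_bigA _ (fun (r : 'I_N.+2) (k : 'I_d) => Qm A0 A1 r i k * f (r, k) y))/=.
  by apply: eq_bigr => r _; rewrite mxE.
exists C => h h1 xh; have := HC h h1 xh.
rewrite -!XE//; [|by rewrite lerDl|by rewrite lerD2l (le_trans (ler_norm _))].
suff <- : \sum_(p : 'I_N.+2 * 'I_d) Qm A0 A1 p.1 i p.2 * l p =
  (A0 *m Xfun sigma A0 A1 Psi dPsi (x - sigma)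
   + Xfun sigma A0 A1 Psi dPsi (x - sigma) *m A1) i j by [].
rewrite (XG N); last by apply: le_trans xN; lra.
rewrite mulmx_sumr mulmx_suml -big_split/= summxE.
rewrite -(pair_bigA _ (fun (r : 'I_N.+2) (k : 'I_d) => Qm A0 A1 r i k * l (r, k)))/=.
rewrite big_ord_recl/= big1 ?add0r; last by move=> k _; rewrite mulr0.
apply: eq_bigr => r _.
(* Commutation moves the right-hand [A1] next to Q_r, which assembles [A0 *m Q_r + Q_r *m A1], the
   next coefficient. *)
rewrite -mulmxA -(Gmx_comm R d sigma A1 Psi dPsi)// !mulmxA -mulmxDl mxE.
apply: eq_bigr => k _; congr (_ * _); rewrite /l/=.
by congr (G _ _ _ _); ring.
Qed.
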